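(* Let $n\ge 1$. The number of complete exceptional sequences of $\Lambda_n$-modules, where $\Lambda_n$ is the linear radical square zero Nakayama algebra of rank $n$, is $$\sum_{j=1}^{n}\binom{n}{j}j^{\,n-j}.$$
   Context: Let $k$ be an algebraically closed field and let $\Lambda_n=kQ/\mathrm{rad}^2(kQ)$ where $Q$ is the linearly oriented quiver $1\to 2\to\cdots\to n$; finite-dimensional $\Lambda_n$-modules are identified with finite-dimensional representations of $Q$ in which the composition of any two consecutive arrows is zero. This $\Lambda_n$ is the linear radical square zero Nakayama algebra of rank $n$. A $\Lambda_n$-module $M$ is exceptional if it is indecomposable, $\mathrm{Hom}(M,M)\cong k$ and $\mathrm{Ext}^i(M,M)=0$ for all $i\ge 1$. A pair $(M,N)$ of exceptional modules is an exceptional pair if $\mathrm{Hom}(N,M)=0$ and $\mathrm{Ext}^i(N,M)=0$ for all $i\ge 1$. A sequence $(M_1,\dots,M_t)$ of exceptional $\Lambda_n$-modules is an exceptional sequence if $(M_i,M_j)$ is an exceptional pair for all $1\le i<j\le t$; it is complete if $t=n$. The entries of exceptional sequences are isomorphism classes of modules. *)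

(* Defs.v *)
From HB Require Import structures.
From mathcomp Require Import all_boot all_order all_algebra.

Set Implicit Arguments.
Unset Strict Implicit.
Unset Printing Implicit Defensive.

Import GRing.Theory.
Local Open Scope ring_scope.

(* Finite-dimensional modules over [kQ / rad^2], [Q] the quiver
   [0 -> 1 -> ... -> n-1] (vertices are numbered from 0): representations of
   [Q] in which any two consecutive arrows compose to zero.  The arrow
   [i -> j] is given by a boolean proof of [i.+1 == j], which is unique. *)
Record rep (k : fieldType) (n : nat) := Rep {
  rspace :> 'I_n -> vectType k;
  rmap : forall i j : 'I_n, i.+1 == j :> nat -> 'Hom(rspace i, rspace j);
  rmap_comp0 : forall (i j l : 'I_n) (ij : i.+1 == j :> nat)
    (jl : j.+1 == l :> nat), (rmap jl \o rmap ij)%VF = 0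
}.

Record rhom (k : fieldType) (n : nat) (M N : rep k n) := RHom {
  rhom_fun :> forall i : 'I_n, 'Hom(M i, N i);
  rhomP : forall (i j : 'I_n) (ij : i.+1 == j :> nat),
    (rhom_fun j \o rmap M ij)%VF = (rmap N ij \o rhom_fun i)%VF
}.

Section Representations.
Variables (k : fieldType) (n : nat).
Implicit Types L M N : rep k n.

Definition rep_iso M N : Prop :=
  exists (f : rhom M N) (g : rhom N M),
    forall i, (g i \o f i)%VF = \1%VF /\ (f i \o g i)%VF = \1%VF.

Definition rep_zero M : Prop := forall i (x : M i), x = 0.

Definition dsum_map M N (i j : 'I_n) (ij : i.+1 == j :> nat) :
    'Hom((M i * N i)%type, (M j * N j)%type) :=
  linfun (fun x : M i * N i => (rmap M ij x.1, rmap N ij x.2)).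

Arguments dsum_map M N [i j] ij.

Lemma dsum_mapE M N (i j : 'I_n) (ij : i.+1 == j :> nat) (x : M i * N i) :
  dsum_map M N ij x = (rmap M ij x.1, rmap N ij x.2).
Proof.
have lin : linear (fun x : M i * N i => (rmap M ij x.1, rmap N ij x.2)).
  by move=> a u v; rewrite /= !linearP.
pose h := GRing.isLinear.Build _ _ _ _ _ lin.
pose F : {linear (M i * N i)%type -> (M j * N j)%type} :=
  HB.pack (fun x : M i * N i => (rmap M ij x.1, rmap N ij x.2)) h.
exact: (lfunE F x).
Qed.

Lemma dsum_comp0 M N (i j l : 'I_n) (ij : i.+1 == j :> nat)
    (jl : j.+1 == l :> nat) :
  (dsum_map M N jl \o dsum_map M N ij)%VF = 0.
Proof.
apply/lfunP => x; rewrite comp_lfunE !dsum_mapE /= -!comp_lfunE !rmap_comp0.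
by rewrite !zero_lfunE.
Qed.

Definition dsum M N : rep k n :=
  Rep (rspace := fun i => (M i * N i)%type : vectType k) (@dsum_comp0 M N).

Definition indecomposable M : Prop :=
  ~ rep_zero M /\
  forall A B : rep k n, rep_iso M (dsum A B) -> rep_zero A \/ rep_zero B.

Definition Hom_eq0 M N : Prop := forall (f : rhom M N) i, f i = 0.

(* [Hom(M, M)] is isomorphic to [k] as a [k]-vector space. *)
Definition End_iso_k M : Prop :=
  exists phi : k -> rhom M M,
    bijective phi /\
    forall a b c i, phi (a * b + c) i = a *: phi b i + phi c i.

Definition rhom_surj M N (f : rhom M N) : Prop := forall i, limg (f i) = fullv.

Definition projective L : Prop :=
  forall M N (g : rhom M N) (f : rhom L N), rhom_surj g ->
    exists h : rhom L M, forall i, (g i \o h i)%VF = f i.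

Record proj_resolution M := ProjResolution {
  res_obj :> nat -> rep k n;
  res_diff : forall m, rhom (res_obj m.+1) (res_obj m);
  res_aug : rhom (res_obj 0) M;
  res_projective : forall m, projective (res_obj m);
  res_aug_surj : rhom_surj res_aug;
  res_exact0 : forall i, limg (res_diff 0 i) = lker (res_aug i);
  res_exactS : forall m i, limg (res_diff m.+1 i) = lker (res_diff m i)
}.

(* [Ext^m(M, N) = 0]: the cohomology of [Hom(P_*, N)] vanishes in degree [m].
   By the comparison theorem the choice of the resolution [P] is immaterial,
   and one exists because there are enough projectives. *)
Definition Ext_eq0 (m : nat) M N : Prop :=
  forall P : proj_resolution M,
  match m with
  | 0 => forall f : rhom (P 0%N) N,
      (forall i, (f i \o res_diff P 0%N i)%VF = 0) -> forall i, f i = 0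
  | m'.+1 => forall f : rhom (P m'.+1) N,
      (forall i, (f i \o res_diff P m'.+1 i)%VF = 0) ->
      exists g : rhom (P m') N, forall i, f i = (g i \o res_diff P m' i)%VF
  end.

Definition exceptional M : Prop :=
  [/\ indecomposable M, End_iso_k M
    & forall m : nat, (1 <= m)%N -> Ext_eq0 m M M].

Definition exceptional_pair M N : Prop :=
  [/\ exceptional M, exceptional N, Hom_eq0 N M
    & forall m : nat, (1 <= m)%N -> Ext_eq0 m N M].

Definition exceptional_seq (t : nat) (s : 'I_t -> rep k n) : Prop :=
  (forall i, exceptional (s i)) /\
  forall i j : 'I_t, (i < j)%N -> exceptional_pair (s i) (s j).

Definition complete_exceptional_seq : ('I_n -> rep k n) -> Prop :=
  @exceptional_seq n.

Definition seq_iso (t : nat) (s s' : 'I_t -> rep k n) : Prop :=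
  forall i, rep_iso (s i) (s' i).

(* There are exactly [N] complete exceptional sequences of isomorphism classes:
   [r] lists one representative of each, without repetition by uniqueness. *)
Definition num_complete_exceptional_seqs (N : nat) : Prop :=
  exists r : 'I_N -> 'I_n -> rep k n,
    (forall a, complete_exceptional_seq (r a)) /\
    forall s, complete_exceptional_seq s -> exists! a, seq_iso s (r a).

End Representations.

(* Main.v *)
From HB Require Import structures.
Require Import Defs.
From mathcomp Require Import all_boot all_order all_algebra.
From mathcomp Require Import zify.
From Stdlib Require Import FunctionalExtensionality Classical.

Set Implicit Arguments.
Unset Strict Implicit.
Unset Printing Implicit Defensive.

(* The exceptional modules are the simples [S_a] and the projectives [P_j] of
   length two.  [P_j] is projective and injective and the cosyzygy of [S_j] is
   [S_(j-1)], so one finds that [(X, Y)] fails to be an exceptional pair exactly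
   for [(S_j, S_i)] with [i <= j], [(P_j, S_(j+1))], [(S_j, P_j)], [(P_j, P_j)]
   and [(P_j, P_(j+1))].

   A complete sequence is thus a word in these letters.  Regard the letters
   [P_i] as edges [i - i+1] of the path on the vertices [0, ..., n-1]; a
   component containing two simples would force a cycle of precedences, and by
   counting there are as many components as simples, so every component
   contains exactly one.  Mapping each position to the position of the simple in
   its component is an idempotent self-map of the [n] positions, and every
   idempotent map arises from exactly one word: the fibres of the map, in the
   order of their fixed points, have the sizes of the successive components.
   There are ['C(n, j) * j ^ (n - j)] idempotent maps with [j] fixed points. *)

(** * Words and idempotent maps *)

(* [(true, a)] stands for the simple [S_a] and [(false, j)] for [P_j]. *)
Local Notation label n := (bool * 'I_n)%type.

Definition label_valid n (x : label n) : bool := x.1 || (x.2.+1 < n).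

Definition label_prec n (x y : label n) : bool :=
  match x, y with
  | (true, j), (true, i) => j < i
  | (false, j), (true, i) => i != j.+1 :> nat
  | (true, j), (false, i) => i != j :> nat
  | (false, j), (false, i) => (i != j :> nat) && (i != j.+1 :> nat)
  end.

Definition exc_words n : {set {ffun 'I_n -> label n}} :=
  [set s : {ffun _ -> _} | [forall p, label_valid (s p)] &&
           [forall p : 'I_n, forall q : 'I_n, (p < q) ==> label_prec (s p) (s q)]].

Lemma exc_wordsP n (s : {ffun 'I_n -> label n}) :
  reflect ((forall p, label_valid (s p)) /\
           forall p q : 'I_n, p < q -> label_prec (s p) (s q))
          (s \in exc_words n).
Proof.
rewrite inE; apply: (iffP andP) => -[/forallP sv sp]; split=> //.
- by move=> p q pq; move/forallP/(_ p)/forallP/(_ q)/implyP: sp; apply.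
- by apply/forallP=> p; apply/forallP=> q; apply/implyP; apply: sp.
Qed.

(** * Counting idempotent maps by their fixed points *)

Definition idempotents n : {set {ffun 'I_n -> 'I_n}} :=
  [set f : {ffun _ -> _} | [forall p, f (f p) == f p]].

Lemma idempotentsP n (f : {ffun 'I_n -> 'I_n}) :
  reflect (forall p, f (f p) = f p) (f \in idempotents n).
Proof. by rewrite inE; apply: (iffP forallP) => h p; apply/eqP. Qed.

(** An idempotent map with fixed set [A] is the identity on [A] and sends the complement into [A]
    arbitrarily, which leaves [#|A| ^ (n - #|A|)] choices; the sets [A] are then grouped by size. *)
Lemma card_idempotents n :
  #|idempotents n| = \sum_(0 <= j < n.+1) 'C(n, j) * j ^ (n - j).
Proof.
pose fixset (f : {ffun 'I_n -> 'I_n}) := [set p | f p == p].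
have fixcard (A : {set 'I_n}) :
    #|[set f in idempotents n | fixset f == A]| = #|A| ^ (n - #|A|).
  pose F p : pred 'I_n := if p \in A then pred1 p else mem A.
  have -> : n - #|A| = #|~: A| by rewrite [RHS]cardsCs setCK card_ord.
  have -> : #|A| ^ #|~: A| = foldr muln 1 [seq #|F p| | p : 'I_n].
    rewrite foldrE big_map enumT (bigID (fun p => p \in A)) /= big1 => [|p pA].
      rewrite mul1n (eq_bigr (fun=> #|A|)) => [|p pA]; last first.
        by rewrite /F (negPf pA).
      by rewrite prod_nat_const; congr (_ ^ _); apply: eq_card => p; rewrite !inE.
    by rewrite /F pA card1.
  apply: etrans (card_family F); apply: eq_card => f; rewrite !inE.
  apply/andP/familyP => [[/forallP fI /eqP fA] p|fF].
    rewrite -topredE /= /F -fA inE; case: ifP => // _.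
    by rewrite /= inE.
  have fixA p : (f p == p) = (p \in A).
    have := fF p; rewrite /F; case: ifP => // pA.
    rewrite inE => fpA; apply/negP => /eqP fp.
    by rewrite fp pA in fpA.
  have fA : fixset f = A by apply/setP => p; rewrite inE.
  split; last exact/eqP.
  apply/forallP => p; rewrite fixA.
  by have := fF p; rewrite /F; case: ifP => // pA; rewrite inE => /eqP ->.
rewrite -sum1_card (partition_big fixset predT) //=.
rewrite (eq_bigr (fun A : {set 'I_n} => #|A| ^ (n - #|A|))) => [|A _]; last first.
  by rewrite -fixcard -sum1_card; apply: eq_bigl => f; rewrite !inE.
have cardlt (A : {set 'I_n}) : #|A| < n.+1.
  by rewrite ltnS -[leqRHS](card_ord n) max_card.
rewrite (partition_big (fun A : {set 'I_n} => Ordinal (cardlt A)) predT) //=.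
rewrite big_mkord; apply: eq_bigr => j _.
rewrite (eq_bigr (fun=> j ^ (n - j))) => [|A /eqP <- //].
rewrite sum_nat_const; congr (_ * _).
rewrite -[X in 'C(X, _)](card_ord n) -card_draws.
by apply: eq_card => A; rewrite !inE.
Qed.

(** * From idempotent maps to words *)

Section Ranking.
Variables (n : nat) (f : {ffun 'I_n -> 'I_n}).

(** Fibres are ordered by their value, positions inside a fibre from right to left. Ranks in this
    order serve as the vertices of the path. *)
Definition before (p q : 'I_n) : bool := (f p < f q) || (f p == f q) && (q < p).

Definition rank_nat (p : 'I_n) : nat := #|[set q | before q p]|.

Lemma before_rank p q : before p q -> rank_nat p < rank_nat q.
Proof.
move=> pq; apply: proper_card; apply/properP; split.
  apply/subsetP => x; rewrite !inE; move: pq; rewrite /before -!val_eqE /=; lia.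
by exists p; rewrite !inE // /before; lia.
Qed.

Lemma before_total p q : p != q -> before p q || before q p.
Proof. by rewrite /before -!val_eqE /=; lia. Qed.

Lemma rank_lt p : rank_nat p < n.
Proof.
rewrite -[X in _ < X](card_ord n) -cardsT; apply: proper_card.
by apply/properP; split=> //; exists p; rewrite !inE // /before; lia.
Qed.

(* A fibre of [f], listed by decreasing position, receives an interval of
   ranks.  Its fixed point of rank [a] becomes the simple [S_a]; going
   left from it one reads [P_a, P_(a+1), ...], going right [P_(a-1), P_(a-2), ...]. *)
Definition word_of_idempotent : {ffun 'I_n -> label n} :=
  [ffun p => (f p == p,
     Ordinal (leq_ltn_trans (leq_subr (p < f p) _) (rank_lt p)))].

Lemma word_of_idempotentE p :
  word_of_idempotent p =
    (f p == p, Ordinal (leq_ltn_trans (leq_subr (p < f p) _) (rank_lt p))).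
Proof. by rewrite ffunE. Qed.

(** A strictly increasing [g] with values below [n] is a bijection onto ['I_n], so the positions
    before [p] correspond to the values below [g p]. *)
Lemma rank_mono_eq (g : 'I_n -> nat) :
  (forall p, g p < n) -> (forall p q, before p q -> g p < g q) ->
  forall p, rank_nat p = g p.
Proof.
move=> gn gm p; pose h q := Ordinal (gn q).
have hinj : injective h.
  move=> x y /(congr1 val) /= e; apply/eqP/negPn/negP => /before_total.
  by case/orP => /gm; rewrite e ltnn.
have -> : rank_nat p = #|h @^-1: [set v : 'I_n | v < g p]|.
  apply: eq_card => q; rewrite !inE /=; apply/idP/idP; first exact: gm.
  move=> qp; have qNp : q != p by apply: contraTneq qp => ->; rewrite ltnn.
  by case/orP: (before_total qNp) => // /gm; lia.
rewrite on_card_preimset; last by apply/onW_bij/injF_bij.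
rewrite -sum1_card (eq_bigl (fun v : 'I_n => v < g p)); last by move=> v; rewrite inE.
by rewrite (big_ord_narrow (ltnW (gn p))) sum1_card card_ord.
Qed.

End Ranking.

Lemma word_of_idempotent_exc n (f : {ffun 'I_n -> 'I_n}) :
  f \in idempotents n -> word_of_idempotent f \in exc_words n.
Proof.
move=> /idempotentsP fI; apply/exc_wordsP.
have H := @before_rank n f; rewrite /before in H.
split=> [p|p q pq]; rewrite !word_of_idempotentE /label_valid /=.
  have := H p (f p); have := H (f p) p; have := rank_lt f p.
  have := rank_lt f (f p); rewrite fI eqxx -val_eqE /=; lia.
(* The ranks of [p], [q] and their fixed points decide each case, once it is known on which side of
   its fixed point each position lies. *)
move: (H p q) (H q p) (H p (f p)) (H (f p) p) (H q (f q)) (H (f q) q).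
move: (H p (f q)) (H (f q) p) (H q (f p)) (H (f p) q) (H (f p) (f q)).
rewrite !fI !eqxx -!val_eqE /=.
by case: (ltngtP (f p) p) => ?; case: (ltngtP (f q) q) => ? /=; lia.
Qed.

(** The word determines the fixed points and their ranks. If [f p < g p], both values are fixed by
    both maps, and [p] ranks below [g p] under [f] but above [f p] under [g]; on whichever side of
    them [p] lies, its two letters then differ. *)
Lemma word_of_idempotent_inj n :
  {in idempotents n &, injective (@word_of_idempotent n)}.
Proof.
have key (f g : {ffun 'I_n -> 'I_n}) p :
    f \in idempotents n -> g \in idempotents n ->
    word_of_idempotent f = word_of_idempotent g -> f p < g p -> False.
  move=> /idempotentsP fI /idempotentsP gI fg lt.
  have E q : (f q == q) = (g q == q) /\
             rank_nat f q - (q < f q) = rank_nat g q - (q < g q).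
    by move/ffunP/(_ q): fg; rewrite !word_of_idempotentE => -[-> ?].
  have ffix x : f x = x -> g x = x.
    by move=> e; have [] := E x; rewrite e eqxx => /esym/eqP.
  have gfix x : g x = x -> f x = x.
    by move=> e; have [] := E x; rewrite e eqxx => /eqP.
  have gf := ffix _ (fI p); have fg' := gfix _ (gI p).
  have [e1 E1] := E p; have [_ E2] := E (f p); have [_ E3] := E (g p).
  move: E2 E3; rewrite fI gI gf fg' !ltnn !subn0 => E2 E3.
  have Hf := @before_rank n f; have Hg := @before_rank n g.
  rewrite /before in Hf Hg.
  move: (Hf p (f p)) (Hf (f p) p) (Hf p (g p)) (Hf (g p) p) (Hf (f p) (g p)).
  move: (Hg p (f p)) (Hg (f p) p) (Hg p (g p)) (Hg (g p) p) (Hg (f p) (g p)).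
  rewrite !fI !gI !gf !fg' !eqxx -!val_eqE /=.
  have pf : f p != p :> nat.
    apply/eqP => /val_inj e; have := ffix _ e => e2.
    by move: lt; rewrite e e2 ltnn.
  have pg : g p != p :> nat.
    apply/eqP => /val_inj e; have := gfix _ e => e2.
    by move: lt; rewrite e e2 ltnn.
  move: pf pg E1.
  by case: (ltngtP (f p) p) => // ? _; case: (ltngtP (g p) p) => // ? _; lia.
move=> f g fI gI fg; apply/ffunP => p; apply/val_inj/eqP.
case: ltngtP => //= lt; exfalso.
  exact: (key _ _ _ fI gI fg lt).
exact: (key _ _ _ gI fI (esym fg) lt).
Qed.

(** * Recovering the idempotent map from a word *)

Section RecoverIdempotent.
Variables (n : nat) (s : {ffun 'I_n -> label n}).
Hypothesis s_exc : s \in exc_words n.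

Implicit Types p q : 'I_n.

Let root p : bool := (s p).1.
Let idx p : nat := (s p).2.

Definition has_edge (i : nat) : bool :=
  [exists p : 'I_n, ~~ (s p).1 && ((s p).2 == i :> nat)].

(* Counts the components of the path [0 - 1 - ... - n.-1], with edges
   [i - i.+1] for the [P_i] occurring in [s], that lie left of vertex [v]. *)
Definition component (v : nat) : nat := \sum_(0 <= i < v) ~~ has_edge i.

Let edge_lt p : ~~ root p -> (idx p).+1 < n.
Proof.
by case/exc_wordsP: s_exc => /(_ p) + _; rewrite /label_valid -/(root p) => /orP[->|].
Qed.

Let prec p q : p < q -> label_prec (s p) (s q).
Proof. by case/exc_wordsP: s_exc => _; apply. Qed.

Let prec_SS p q : root p -> root q -> p < q -> idx p < idx q.
Proof.
by rewrite /root /idx => rp rq /prec; case: (s p) (s q) rp rq => [[] ?] [[] ?].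
Qed.

Let prec_SP p q : root p -> ~~ root q -> idx q = idx p -> q < p.
Proof.
move=> rp rq e; have qp : q != p by apply: contraNneq rq => ->.
have: ~~ (p < q).
  apply/negP => /prec; move: rp rq e; rewrite /root /idx.
  by case: (s p) (s q) => [[] ?] [[] ?] //= _ _ ->; rewrite eqxx.
by move: qp; rewrite -val_eqE /=; lia.
Qed.

Let prec_PS p q : ~~ root p -> root q -> idx q = (idx p).+1 -> q < p.
Proof.
move=> rp rq e; have qp : q != p by apply: contraTneq rq => ->.
have: ~~ (p < q).
  apply/negP => /prec; move: rp rq e; rewrite /root /idx.
  by case: (s p) (s q) => [[] ?] [[] ?] //= _ _ ->; rewrite eqxx.
by move: qp; rewrite -val_eqE /=; lia.
Qed.

Let prec_PP p q : ~~ root p -> ~~ root q -> idx q = (idx p).+1 -> q < p.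
Proof.
move=> rp rq e; have qp : q != p by apply/eqP => qp; move: e; rewrite qp; lia.
have: ~~ (p < q).
  apply/negP => /prec; move: rp rq e; rewrite /root /idx.
  by case: (s p) (s q) => [[] ?] [[] ?] //= _ _ ->; rewrite eqxx andbF.
by move: qp; rewrite -val_eqE /=; lia.
Qed.

Let idx_inj_P p q : ~~ root p -> ~~ root q -> idx p = idx q -> p = q.
Proof.
move=> rp rq e; apply/eqP/negPn/negP; rewrite -val_eqE neq_ltn => /orP[] /prec;
  move: rp rq e; rewrite /root /idx;
  by case: (s p) (s q) => [[] ?] [[] ?] //= _ _ ->; rewrite eqxx.
Qed.

Let edgeP i : reflect (exists2 p, ~~ root p & idx p = i) (has_edge i).
Proof.
apply: (iffP existsP) => [[p /andP[rp /eqP]]|[p rp e]]; first by exists p.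
by exists p; rewrite rp -/(idx p) e eqxx.
Qed.

Let componentS v : component v.+1 = component v + ~~ has_edge v.
Proof. by rewrite /component big_nat_recr. Qed.

Let component_mono u v : u <= v -> component u <= component v.
Proof.
elim: v => [|v IH]; first by rewrite leqn0 => /eqP ->.
rewrite leq_eqVlt => /orP[/eqP -> //|]; rewrite ltnS => /IH h.
by rewrite componentS; apply: leq_trans h (leq_addr _ _).
Qed.

Let component_edge u v i : component u = component v -> u <= i < v -> has_edge i.
Proof.
move=> e /andP[ui iv]; have := component_mono ui; have := component_mono iv.
by rewrite componentS; case: (has_edge i) => //=; lia.
Qed.

(** Since [component] is constant between the two indices, all edges in between occur in [s], and
    each [P_(i+1)] stands strictly left of [P_i]. *)
Let chain d p q : ~~ root p -> ~~ root q -> idx p = idx q + d ->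
  component (idx p) = component (idx q) -> p + d <= q.
Proof.
elim: d p q => [|d IH] p q rp rq e c.
  by rewrite addn0 (idx_inj_P rp rq) //; lia.
have /edgeP[z rz ez] : has_edge (idx q + d).
  by apply: (component_edge (esym c)); lia.
have cz : component (idx z) = component (idx q).
  have := @component_mono (idx z) (idx p); have := @component_mono (idx q) (idx z).
  by rewrite c; lia.
have := IH z q rz rq ez cz; have := prec_PP rz rp; lia.
Qed.

Let chain_le p q : ~~ root p -> ~~ root q -> idx q <= idx p ->
  component (idx p) = component (idx q) -> p <= q.
Proof.
move=> rp rq le c; have := @chain (idx p - idx q) p q rp rq _ c.
by rewrite subnKC // => /(_ erefl); lia.
Qed.

(** Simples [S_a], [S_b] with [a < b] in one component would give a cycle: [P_a] stands before
    [S_a], [S_a] before [S_b], [S_b] before [P_(b-1)], and [P_(b-1)] not after [P_a]. *)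
Let root_component_neq p q : root p -> root q -> p < q ->
  component (idx p) != component (idx q).
Proof.
move=> rp rq pq; apply/eqP => c; have lt := prec_SS rp rq pq.
have /edgeP[x rx ex] : has_edge (idx p) by apply: (component_edge c); lia.
have /edgeP[y ry ey] : has_edge (idx q).-1 by apply: (component_edge c); lia.
have xp := prec_SP rp rx ex.
have qy : q < y by apply: (prec_PS ry rq); lia.
have : y <= x.
  apply: chain_le => //; first lia.
  have := @component_mono (idx p) (idx y); have := @component_mono (idx y) (idx q).
  by rewrite ex c; lia.
lia.
Qed.

Let root_component_inj p q : root p -> root q ->
  component (idx p) = component (idx q) -> p = q.
Proof.
move=> rp rq c; apply/val_inj/eqP; case: ltngtP => // lt; exfalso.
  by move/eqP: (root_component_neq rp rq lt).
by move/eqP: (root_component_neq rq rp lt); rewrite c.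
Qed.

(* There are as many components as fixed points: [n] minus the number of edges. *)
Let component_lt v : v < n -> component v < #|[set p | root p]|.
Proof.
move=> vn; apply: leq_ltn_trans (component_mono (_ : v <= n.-1)) _; first lia.
have cardE : #|[set p | root p]| + #|[set p | ~~ root p]| = n.
  by rewrite -[RHS](card_ord n) -(cardsC [set p | root p]);
     congr (_ + _); apply: eq_card => p; rewrite !inE.
have sumE : component n.-1 + \sum_(0 <= i < n.-1) has_edge i = n.-1.
  rewrite -big_split /= -[RHS]subn0 -[RHS]muln1 -sum_nat_const_nat.
  by apply: eq_bigr => i _; case: has_edge.
suff : #|[set p | ~~ root p]| <= \sum_(0 <= i < n.-1) has_edge i by lia.
have -> : \sum_(0 <= i < n.-1) has_edge i = #|[set i : 'I_n.-1 | has_edge i]|.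
  by rewrite big_mkord -sum1_card [RHS]big_mkcond /=; apply: eq_bigr => i _;
     rewrite inE; case: has_edge.
have n1 : 0 < n.-1 \/ [set p | ~~ root p] = set0.
  case: (set_0Vmem [set p | ~~ root p]) => [|[p]]; first by right.
  by rewrite inE => /edge_lt; left; lia.
case: n1 => [n1|->]; last by rewrite cards0.
pose h p : 'I_n.-1 := insubd (Ordinal n1) (idx p).
have hE p : ~~ root p -> h p = idx p :> nat.
  by move=> /edge_lt lt; rewrite val_insubd ifT //; lia.
rewrite -(card_in_imset (f := h)) => [|p q]; last first.
  rewrite !inE => rp rq /(congr1 val) /=.
  by rewrite !hE // => /idx_inj_P; apply.
apply: subset_leq_card; apply/subsetP => _ /imsetP[p + ->]; rewrite !inE => rp.
by rewrite hE //; apply/edgeP; exists p.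
Qed.

(** Pigeonhole: the roots lie in distinct components, whose numbers are below the number of roots,
    so every such number is attained. *)
Let root_exists v : v < n -> exists2 q, root q & component (idx q) = component v.
Proof.
move=> vn; have lt := component_lt vn.
pose R := [set p | root p].
pose h p : 'I_#|R| := insubd (Ordinal lt) (component (idx p)).
have hE p : h p = component (idx p) :> nat.
  by rewrite val_insubd ifT //; apply/component_lt/ltn_ord.
have : h @: R = [set: 'I_#|R|].
  apply/eqP; rewrite eqEcard subsetT cardsT card_ord card_in_imset ?leqnn //.
  move=> p q; rewrite !inE => rp rq /(congr1 val) /=; rewrite !hE.
  exact: root_component_inj.
move/setP/(_ (Ordinal lt)); rewrite in_setT => /imsetP[q].
rewrite inE => rq e; exists q => //.
by rewrite -hE -e.
Qed.

(** The default [p] is never reached, because [root_exists] finds a root in every component. *)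
Definition root_of (p : 'I_n) : 'I_n :=
  odflt p [pick q | (s q).1 && (component (s q).2 == component (s p).2)].

Let root_ofP p : root (root_of p) /\ component (idx (root_of p)) = component (idx p).
Proof.
rewrite /root_of; case: pickP => [q /andP[rq /eqP]|no] /=; first by split.
have [q rq e] := root_exists (ltn_ord (s p).2).
by have := no q; rewrite -/(root q) rq e eqxx.
Qed.

Let root_of_root p : root p -> root_of p = p.
Proof. by have [rr e] := root_ofP p => rp; apply: root_component_inj. Qed.

Let root_of_fix p : (root_of p == p) = root p.
Proof.
apply/eqP/idP => [<-|]; [exact: (root_ofP p).1|exact: root_of_root].
Qed.

(** Let [S_a] be the root. Within the component, [P_a] stands left of [S_a] and edges of larger
    index further left; [P_(a-1)] stands right of [S_a] and edges of smaller index further right. *)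
Let before_root p : ~~ root p -> (p < root_of p) = (idx (root_of p) <= idx p).
Proof.
move=> rp; have [rr c] := root_ofP p.
case: (leqP (idx (root_of p)) (idx p)) => le.
  have /edgeP[z rz ez] : has_edge (idx (root_of p)).
    move: le; rewrite leq_eqVlt => /orP[/eqP ->|lt]; first by apply/edgeP; exists p.
    by apply: (component_edge c); lia.
  have := prec_SP rr rz ez; have := @chain_le p z rp rz; rewrite ez c; lia.
have /edgeP[z rz ez] : has_edge (idx (root_of p)).-1.
  by apply: (component_edge (esym c)); lia.
have cz : component (idx z) = component (idx p).
  have := @component_mono (idx p) (idx z).
  by have := @component_mono (idx z) (idx (root_of p)); rewrite c; lia.
have := prec_PS rz rr; have := @chain_le z p rz rp; rewrite cz; lia.
Qed.

(** For an edge, this is its endpoint farther from the root; adding the boolean undoes the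
    subtraction in [word_of_idempotent]. *)
Let rnk p := idx p + (p < root_of p).

Let rnk_root p : root p -> rnk p = idx p.
Proof. by move=> /root_of_root e; rewrite /rnk e ltnn addn0. Qed.

Let rnk_lt p : rnk p < n.
Proof.
have [rp|rp] := boolP (root p); first by rewrite rnk_root // ltn_ord.
by rewrite /rnk; have := edge_lt rp; case: ltnP; lia.
Qed.

Let component_rnk p : component (rnk p) = component (idx p).
Proof.
have [rp|rp] := boolP (root p); first by rewrite rnk_root.
rewrite /rnk; case: ltnP => _; last by rewrite addn0.
have e : has_edge (idx p) by apply/edgeP; exists p.
by rewrite addn1 componentS e addn0.
Qed.

Let f : {ffun 'I_n -> 'I_n} := finfun root_of.

(** Through [rank_mono_eq] this identifies [rnk] with the rank. Different fibres are separated by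
    their components; inside a fibre, edges of larger index stand further left. *)
Let rnk_mono p q : before f p q -> rnk p < rnk q.
Proof.
rewrite /before !ffunE => /orP[lt|/andP[/eqP e qp]].
  have [rp cp] := root_ofP p; have [rq cq] := root_ofP q.
  have lti := prec_SS rp rq lt.
  have := component_mono (ltnW lti); have := root_component_neq rp rq lt.
  rewrite cp cq -component_rnk -[X in _ != X]component_rnk => ne.
  have := @component_mono (rnk q) (rnk p); rewrite !component_rnk in ne *; lia.
have [rp cp] := root_ofP p; have [rq cq] := root_ofP q.
have [Rp|Rp] := boolP (root p); have [Rq|Rq] := boolP (root q).
- by move: qp; rewrite -(root_of_root Rp) -(root_of_root Rq) e ltnn.
- have := before_root Rq; rewrite -e (root_of_root Rp) rnk_root // /rnk -e.
  by rewrite (root_of_root Rp) qp; lia.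
- have := before_root Rp; rewrite e (root_of_root Rq) [rnk q]rnk_root // /rnk e.
  by rewrite (root_of_root Rq) ltnNge (ltnW qp) /=; lia.
have := before_root Rp; have := before_root Rq; rewrite /rnk e.
have := @chain_le p q Rp Rq; rewrite -cp -cq e => /(_ _ erefl).
by case: (ltnP p (root_of q)); case: (ltnP q (root_of q)); lia.
Qed.

Lemma exc_word_of_idempotent :
  exists2 f, f \in idempotents n & word_of_idempotent f = s.
Proof.
exists f.
  apply/idempotentsP => p; rewrite !ffunE root_of_root //.
  by case: (root_ofP p).
apply/ffunP => p; rewrite word_of_idempotentE; have rE := rank_mono_eq rnk_lt rnk_mono.
rewrite [RHS]surjective_pairing; congr (_, _); first by rewrite ffunE root_of_fix.
by apply: val_inj; rewrite /= rE /rnk !ffunE addnK.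
Qed.

End RecoverIdempotent.

Lemma card_exc_words n :
  #|exc_words n| = \sum_(0 <= j < n.+1) 'C(n, j) * j ^ (n - j).
Proof.
rewrite -card_idempotents -(card_in_imset (@word_of_idempotent_inj n)).
apply: eq_card => s; apply/idP/imsetP => [/exc_word_of_idempotent[f fI <-]|[f fI ->]].
  by exists f.
exact: word_of_idempotent_exc.
Qed.

Import GRing.Theory.
Local Open Scope ring_scope.

(** * Homomorphisms and thin representations *)

Lemma linfunE (k : fieldType) (U V : vectType k) (f : U -> V) :
  linear f -> linfun f =1 f.
Proof.
move=> lin x; pose h := GRing.isLinear.Build _ _ _ _ _ lin.
pose F : {linear U -> V} := HB.pack f h.
exact: (lfunE F x).
Qed.

(** * Spaces of dimension at most one *)

Section ThinSpace.
Variable k : fieldType.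

(** Rows of boolean length give [k] or zero without a case distinction in the type; the sum reads
    the only entry, or is zero. *)
Definition bval (b : bool) (x : 'rV[k]_b) : k := \sum_j x 0 j.
Definition bvec (b : bool) (c : k) : 'rV[k]_b := const_mx c.

Lemma bvecK b c : bval (bvec b c) = c *+ b.
Proof. by rewrite /bval; under eq_bigr do rewrite mxE; rewrite sumr_const card_ord. Qed.

Lemma bvalK b : cancel (@bval b) (bvec b).
Proof.
case: b => x; apply/rowP=> j.
  by rewrite mxE /bval (big_ord1 _ (fun j => x 0 j)) (ord1 j).
by case: j.
Qed.

Lemma bval_linear (b : bool) a (x y : 'rV[k]_b) : bval (a *: x + y) = a * bval x + bval y.
Proof.
rewrite /bval mulr_sumr -big_split /=.
by apply: eq_bigr => j _; rewrite !mxE.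
Qed.

Lemma bvec_linear b (a x y : k) : bvec b (a * x + y) = a *: bvec b x + bvec b y.
Proof. by apply/rowP => j; rewrite !mxE. Qed.

Lemma bval_inj b : injective (@bval b).
Proof. exact: can_inj (@bvalK b). Qed.

Lemma bval0 (b : bool) : bval (0 : 'rV[k]_b) = 0.
Proof. by rewrite /bval big1 // => ? _; rewrite mxE. Qed.

Lemma bvalZ (b : bool) a (x : 'rV[k]_b) : bval (a *: x) = a * bval x.
Proof. by rewrite -[a *: x]addr0 bval_linear bval0 addr0. Qed.

Lemma bval_eq0 (b : bool) (x : 'rV[k]_b) : ~~ b -> bval x = 0.
Proof. by case: b x => // x _; rewrite /bval big_ord0. Qed.

Definition from_thin (V : vectType k) (b : bool) (w : V) : 'Hom('rV[k]_b, V) :=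
  linfun (fun x : 'rV[k]_b => bval x *: w).

Lemma from_thinE (V : vectType k) (b : bool) (w : V) x : from_thin b w x = bval x *: w.
Proof.
by rewrite linfunE // => a y z; rewrite bval_linear scalerDl scalerA.
Qed.

Definition to_thin (V : vectType k) (b : bool) (l : 'Hom(V, k^o)) : 'Hom(V, 'rV[k]_b) :=
  linfun (fun x => bvec b (l x)).

Lemma to_thinE (V : vectType k) (b : bool) (l : 'Hom(V, k^o)) x :
  to_thin b l x = bvec b (l x).
Proof. by rewrite linfunE // => a y z; rewrite linearP /= bvec_linear. Qed.

End ThinSpace.

Section RepHom.
Variables (k : fieldType) (n : nat).
Implicit Types L M N : rep k n.

Lemma rhomE M N (f : rhom M N) (i j : 'I_n) (ij : i.+1 == j :> nat) x :
  f j (rmap M ij x) = rmap N ij (f i x).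
Proof. by rewrite -!comp_lfunE rhomP. Qed.

Lemma rmap_rmap0 M (i j l : 'I_n) (ij : i.+1 == j :> nat) (jl : j.+1 == l :> nat) x :
  rmap M jl (rmap M ij x) = 0.
Proof. by rewrite -comp_lfunE rmap_comp0 zero_lfunE. Qed.

Lemma mk_rhom_subproof M N (f : forall i, 'Hom(M i, N i)) :
  (forall (i j : 'I_n) (ij : i.+1 == j :> nat) x,
     f j (rmap M ij x) = rmap N ij (f i x)) ->
  forall (i j : 'I_n) (ij : i.+1 == j :> nat),
    (f j \o rmap M ij)%VF = (rmap N ij \o f i)%VF.
Proof. by move=> h i j ij; apply/lfunP => x; rewrite !comp_lfunE. Qed.

Definition mk_rhom M N (f : forall i, 'Hom(M i, N i)) h : rhom M N :=
  RHom (mk_rhom_subproof (f := f) h).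

(** [End_iso_k] asks for a bijection, hence for Leibniz equality of morphisms; the commutation
    proofs agree by irrelevance of equality proofs. *)
Lemma eq_rhom M N (f g : rhom M N) : (forall i, f i = g i) -> f = g.
Proof.
case: f g => [f fP] [g gP] /= e; have E := functional_extensionality_dep _ _ e.
subst g; congr RHom; do 3![apply: functional_extensionality_dep => ?].
exact: eq_irrelevance.
Qed.

Definition rid M : rhom M M.
Proof. by exists (fun i => \1%VF) => i j ij; rewrite comp_lfun1l comp_lfun1r. Defined.

Definition rcomp L M N (g : rhom M N) (f : rhom L M) : rhom L N.
Proof.
exists (fun i => (g i \o f i)%VF) => i j ij.
by rewrite -comp_lfunA rhomP comp_lfunA rhomP comp_lfunA.
Defined.

Definition rscale M N (a : k) (f : rhom M N) : rhom M N.
Proof.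
exists (fun i => a *: f i) => i j ij.
by rewrite -comp_lfunZl -comp_lfunZr rhomP.
Defined.

Definition radd M N (f g : rhom M N) : rhom M N.
Proof.
exists (fun i => f i + g i) => i j ij.
by rewrite comp_lfunDl comp_lfunDr !rhomP.
Defined.

Lemma rep_isoP M N :
  rep_iso M N <-> exists (f : rhom M N) (g : rhom N M),
    forall i, cancel (f i) (g i) /\ cancel (g i) (f i).
Proof.
split=> -[f [g fg]]; exists f, g => i; have [fg1 fg2] := fg i.
  by split=> x; rewrite -comp_lfunE (fg1, fg2) id_lfunE.
by split; apply/lfunP => x; rewrite comp_lfunE id_lfunE.
Qed.

Lemma rep_iso_sym M N : rep_iso M N -> rep_iso N M.
Proof. by case=> f [g fg]; exists g, f => i; have [] := fg i. Qed.

Lemma rep_iso_trans M N L : rep_iso M N -> rep_iso N L -> rep_iso M L.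
Proof.
move=> /rep_isoP[f [f' ff']] /rep_isoP[g [g' gg']]; apply/rep_isoP.
exists (rcomp g f), (rcomp f' g') => i.
have [ff1 ff2] := ff' i; have [gg1 gg2] := gg' i.
by split=> x; rewrite /= !comp_lfunE (gg1, ff2) (ff1, gg2).
Qed.

(** [phi] is merely a linear bijection, so [phi 1] may differ from the identity; still, the identity
    is a nonzero multiple of [phi 1], and every endomorphism is a multiple of [phi 1]. *)
Lemma End_scalar M : End_iso_k M -> ~ rep_zero M ->
  forall e : rhom M M, exists c : k, forall i x, e i x = c *: x.
Proof.
case=> phi [[psi _ psiK] lin] M0.
have phi0 i : phi 0 i = 0.
  have := lin 1 0 0 i; rewrite mul1r addr0 scale1r => /eqP.
  by rewrite -subr_eq0 opprD addrA subrr sub0r oppr_eq0 => /eqP.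
have phiE a i : phi a i = a *: phi 1 i.
  by have := lin a 1 0 i; rewrite mulr1 addr0 phi0 addr0.
have idE i : \1%VF = psi (rid M) *: phi 1 i by rewrite -phiE psiK.
have idxE i x : x = psi (rid M) *: phi 1 i x.
  by rewrite -scale_lfunE -idE id_lfunE.
have d0 : psi (rid M) != 0.
  by apply/eqP => d0; apply: M0 => i x; rewrite (idxE i x) d0 scale0r.
move=> e; exists (psi e / psi (rid M)) => i x.
by rewrite -{1}(psiK e) phiE scale_lfunE {2}(idxE i x) scalerA mulfVK.
Qed.

End RepHom.

(** * Thin representations and their canonical maps *)

Section ThinRep.
Variables (k : fieldType) (n : nat).
Implicit Types L M N : rep k n.

(* [thin true a] is the simple [S_a] and [thin false a] the projective [P_a]; it
   is simple for [a = n-1] and zero for [n <= a], so that the projective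
   resolution of a simple needs no truncation. *)
Definition supp (s : bool) (a v : nat) : bool := (v == a) || ~~ s && (v == a.+1).

Definition thin_space s a (v : 'I_n) : vectType k := 'rV[k]_(supp s a v).

Definition thin_map s a (i j : 'I_n) (ij : i.+1 == j :> nat) :
  'Hom(thin_space s a i, thin_space s a j) := from_thin _ (bvec (supp s a j) 1).

Lemma thin_mapE s a (i j : 'I_n) (ij : i.+1 == j :> nat) x :
  bval (thin_map s a ij x) = bval x *+ supp s a j.
Proof.
by rewrite from_thinE bvalZ bvecK mulrnAr mulr1.
Qed.

Lemma thin_comp0 s a (i j l : 'I_n) (ij : i.+1 == j :> nat) (jl : j.+1 == l :> nat) :
  (thin_map s a jl \o thin_map s a ij)%VF = 0.
Proof.
apply/lfunP => x; apply: (@bval_inj k (supp s a l)).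
rewrite comp_lfunE zero_lfunE !thin_mapE bval0.
case/orP: (orbN (supp s a i)) => [si|/bval_eq0 ->]; last by rewrite !mul0rn.
rewrite -mulrnA; suff -> : (supp s a j * supp s a l = 0)%N by rewrite mulr0n.
by move: si ij jl; rewrite /supp; lia.
Qed.

Definition thin s a : rep k n := Rep (@thin_comp0 s a).

Definition coor s a (i : 'I_n) (x : thin s a i) : k := @bval k (supp s a i) x.

Lemma coor0 s a (i : 'I_n) : coor (0 : thin s a i) = 0.
Proof. exact: bval0. Qed.

Lemma coorZ s a (i : 'I_n) c (x : thin s a i) : coor (c *: x) = c * coor x.
Proof. exact: bvalZ. Qed.

Lemma coor_rmap s a (i j : 'I_n) (ij : i.+1 == j :> nat) (x : thin s a i) :
  coor (rmap (thin s a) ij x) = coor x *+ supp s a j.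
Proof. exact: thin_mapE. Qed.

Lemma coor_inj s a (i : 'I_n) : injective (@coor s a i).
Proof. exact: bval_inj. Qed.

Lemma coor_out s a (i : 'I_n) (x : thin s a i) : ~~ supp s a i -> coor x = 0.
Proof. exact: bval_eq0. Qed.

Lemma thin_zero s a (i : 'I_n) (x : thin s a i) : ~~ supp s a i -> x = 0.
Proof. by move=> si; apply: coor_inj; rewrite coor_out // coor0. Qed.

Definition gen s a (i : 'I_n) : thin s a i := bvec (supp s a i) 1.

Lemma coor_gen s a i : coor (gen s a i) = (supp s a i)%:R.
Proof. exact: bvecK. Qed.

Lemma coor_genE s a (i : 'I_n) (x : thin s a i) : x = coor x *: gen s a i.
Proof.
have [si|si] := boolP (supp s a i); last by rewrite [LHS]thin_zero // [RHS]thin_zero.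
by apply: coor_inj; rewrite coorZ coor_gen si mulr1.
Qed.

Definition thin_from s a (i : 'I_n) (V : vectType k) (w : V) : 'Hom(thin s a i, V) :=
  from_thin (supp s a i) w.

Lemma thin_fromE s a (i : 'I_n) (V : vectType k) (w : V) (x : thin s a i) :
  thin_from s a i w x = coor x *: w.
Proof. exact: from_thinE. Qed.

Definition thin_to s a (i : 'I_n) (V : vectType k) (l : 'Hom(V, k^o)) :
  'Hom(V, thin s a i) :=
  to_thin (supp s a i) l.

Lemma coor_thin_to s a (i : 'I_n) (V : vectType k) (l : 'Hom(V, k^o)) x :
  coor (thin_to s a i l x) = l x *+ supp s a i.
Proof. by rewrite /coor /thin_to to_thinE bvecK. Qed.

Lemma gen_succ s a (i j : 'I_n) (ij : i.+1 == j :> nat) :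
  supp s a i -> rmap (thin s a) ij (gen s a i) = gen s a j.
Proof. by move=> si; apply: coor_inj; rewrite coor_rmap !coor_gen si. Qed.

Lemma thin_hom_eq (a : 'I_n) s M (f g : rhom (thin s a) M) :
  f a (gen s a a) = g a (gen s a a) -> forall i, f i = g i.
Proof.
move=> e i; have sa : supp s a a by rewrite /supp eqxx.
suff E : f i (gen s a i) = g i (gen s a i).
  by apply/lfunP => x; rewrite (coor_genE x) !linearZ /= E.
have [si|si] := boolP (supp s a i); last first.
  by rewrite [gen _ _ _]thin_zero // !linear0.
have [ia|ia] := eqVneq i a; first by rewrite ia.
have ai : a.+1 == i :> nat by move: si ia; rewrite /supp -val_eqE /=; lia.
by rewrite -(gen_succ ai sa) !rhomE e.
Qed.

(** This makes the maps sending [gen] to [gen] commute with the arrows: both composites from [v] to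
    [v.+1] are nonzero, or both vanish. *)
Definition thin_compat (s : bool) (a : nat) (s' : bool) (a' : nat) :=
  forall v, (v.+1 < n)%N -> supp s a v -> supp s' a' v.+1 ->
    supp s a v.+1 = supp s' a' v.

Lemma thin_hom_subproof s a s' a' : thin_compat s a s' a' ->
  forall (i j : 'I_n) (ij : i.+1 == j :> nat) (x : thin s a i),
  thin_from s a j (gen s' a' j) (rmap (thin s a) ij x) =
  rmap (thin s' a') ij (thin_from s a i (gen s' a' i) x).
Proof.
move=> co i j ij x; apply: coor_inj.
rewrite coor_rmap !thin_fromE !coorZ !coor_gen.
have [si|/coor_out ->] := boolP (supp s a i); last by rewrite !mul0r mul0rn.
have [sj|_] := boolP (supp s' a' j); last by rewrite mulr0.
move/eqP: (ij) => e; have := co i; rewrite e ltn_ord => -> //.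
by rewrite mulr1.
Qed.

Definition thin_hom s a s' a' (co : thin_compat s a s' a') :
  rhom (thin s a) (thin s' a') := mk_rhom (thin_hom_subproof co).

Lemma thin_homE s a s' a' (co : thin_compat s a s' a') i x :
  coor (thin_hom co i x) = coor x *+ supp s' a' i.
Proof. by rewrite /= thin_fromE coorZ coor_gen mulr_natr. Qed.

Lemma thin_hom_neq0 s a s' a' (v : 'I_n) : thin_compat s a s' a' ->
  supp s a v -> supp s' a' v -> ~ Hom_eq0 (thin s a) (thin s' a').
Proof.
move=> co sv sv' /(_ (thin_hom co) v) /lfunP/(_ (gen s a v)) /(congr1 (@coor _ _ _)).
rewrite thin_homE coor_gen sv sv' zero_lfunE coor0 => /eqP.
by rewrite oner_eq0.
Qed.

(** In dimension at most one, exactness at a nonzero middle term means that exactly one of the outer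
    terms is nonzero. *)
Lemma thin_hom_exact s1 a1 s2 a2 s3 a3 (c12 : thin_compat s1 a1 s2 a2)
    (c23 : thin_compat s2 a2 s3 a3) (v : 'I_n) :
  (supp s2 a2 v -> supp s1 a1 v = ~~ supp s3 a3 v) ->
  limg (thin_hom c12 v) = lker (thin_hom c23 v).
Proof.
move=> ex; apply/vspaceP => y; rewrite memv_ker.
have [sv|sv] := boolP (supp s2 a2 v); last by rewrite (thin_zero y sv) mem0v linear0 eqxx.
have {}ex := ex sv; have [s3v|s3v] := boolP (supp s3 a3 v).
  have s1v : ~~ supp s1 a1 v by rewrite ex s3v.
  apply/memv_imgP/eqP => [[x _ ->]|/(congr1 (@coor _ _ _))].
    by rewrite (thin_zero x s1v) !linear0.
  rewrite thin_homE s3v coor0 mulr1n => y0; exists 0; rewrite ?mem0v // linear0.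
  by apply: coor_inj; rewrite y0 coor0.
rewrite (thin_zero (thin_hom c23 v y) s3v) eqxx; apply/memv_imgP.
exists (coor y *: gen s1 a1 v); first exact: memvf.
apply: coor_inj; rewrite thin_homE coorZ coor_gen ex s3v sv.
by rewrite mulr1.
Qed.

Lemma thin_hom_surj s1 a1 s2 a2 (c12 : thin_compat s1 a1 s2 a2) :
  (forall v : 'I_n, supp s2 a2 v -> supp s1 a1 v) -> rhom_surj (thin_hom c12).
Proof.
move=> sub v; apply/vspaceP => y; rewrite memvf; apply/memv_imgP.
exists (coor y *: gen s1 a1 v); first exact: memvf.
apply: coor_inj; rewrite thin_homE coorZ coor_gen.
have [sv|sv] := boolP (supp s2 a2 v); first by rewrite sub // mulr1.
by rewrite coor_out // mul0r.
Qed.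

Lemma thin_hom_inj s1 a1 s2 a2 (c12 : thin_compat s1 a1 s2 a2) :
  (forall v : 'I_n, supp s1 a1 v -> supp s2 a2 v) ->
  forall i x, thin_hom c12 i x = 0 -> x = 0.
Proof.
move=> sub v x /(congr1 (@coor _ _ _)); rewrite thin_homE coor0.
have [sv|sv] := boolP (supp s1 a1 v); last by rewrite (thin_zero x sv).
by rewrite sub // mulr1n => x0; apply: coor_inj; rewrite x0 coor0.
Qed.

Lemma thin_hom_eq0 s a s' a' :
  (forall v : 'I_n, supp s a v -> supp s' a' v ->
     ((v.+1 < n)%N /\ supp s' a' v.+1 && ~~ supp s a v.+1) \/
     ((0 < v)%N /\ supp s a v.-1 && ~~ supp s' a' v.-1)) ->
  Hom_eq0 (thin s a) (thin s' a').
Proof.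
move=> H f v; apply/lfunP => x; rewrite zero_lfunE.
have [sv|sv] := boolP (supp s a v); last by rewrite (thin_zero x sv) linear0.
have [sv'|sv'] := boolP (supp s' a' v); last exact: thin_zero.
case: (H v sv sv') => -[vn /andP[s1 s2]].
  have vj : v.+1 == Ordinal vn :> nat by [].
  have /(congr1 (@coor _ _ _)) : rmap (thin s' a') vj (f v x) = 0.
    by rewrite -rhomE (thin_zero (rmap _ _ _)) // linear0.
  rewrite coor_rmap s1 mulr1n coor0 => e.
  by apply: coor_inj; rewrite e coor0.
have un : (v.-1 < n)%N by apply: leq_ltn_trans (leq_pred _) _.
have uv : (Ordinal un).+1 == v :> nat by rewrite /= prednK.
suff e : f v (gen s a v) = 0 by rewrite (coor_genE x) linearZ /= e scaler0.
by rewrite -(gen_succ uv) // rhomE (thin_zero (f _ _)) // linear0.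
Qed.

End ThinRep.

(** * Extensions *)

Lemma dual_vec (k : fieldType) (V : vectType k) (x : V) :
  x <> 0 -> exists l : 'Hom(V, k^o), l x = 1.
Proof.
move/eqP=> x0; have fx : free [tuple x] by rewrite seq1_free.
exists (linfun (coord [tuple x] ord0 : V -> k^o)); rewrite lfunE.
by have := coord_free ord0 ord0 fx; rewrite /= => ->.
Qed.

Section Homological.
Variables (k : fieldType) (n : nat).
Implicit Types L M N : rep k n.

Lemma rhom_surjP M N (f : rhom M N) :
  rhom_surj f <-> forall i y, exists x, f i x = y.
Proof.
split=> [fs i y|fs i].
  by have := memvf y; rewrite -(fs i) => /memv_imgP[x _ ->]; exists x.
apply/vspaceP => y; rewrite memvf; apply/memv_imgP.
by have [x <-] := fs i y; exists x; rewrite ?memvf.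
Qed.

(** The vertexwise pseudo-inverse of [iota] gives the lift; commutation with the arrows is tested
    after applying the injective [iota]. *)
Lemma rhom_lift_mono L M N (iota : rhom M N) (h : rhom L N) :
  (forall i x, iota i x = 0 -> x = 0) -> (forall i x, exists y, iota i y = h i x) ->
  exists h' : rhom L M, forall i x, iota i (h' i x) = h i x.
Proof.
move=> inj fact.
have E i x : iota i (((iota i)^-1 \o h i)%VF x) = h i x.
  rewrite comp_lfunE limg_lfunVK //; have [y <-] := fact i x.
  by apply: memv_img; apply: memvf.
suff hP (i j : 'I_n) (ij : i.+1 == j :> nat) x :
    ((iota j)^-1 \o h j)%VF (rmap L ij x) = rmap M ij (((iota i)^-1 \o h i)%VF x).
  by exists (mk_rhom (f := fun i => ((iota i)^-1 \o h i)%VF) hP).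
apply/eqP; rewrite -subr_eq0; apply/eqP/(inj j).
by rewrite linearB /= E !rhomE E subrr.
Qed.

Lemma rhom_desc_epi L M N (p : rhom L M) (g : rhom L N) :
  rhom_surj p -> (forall i x, p i x = 0 -> g i x = 0) ->
  exists g' : rhom M N, forall i x, g' i (p i x) = g i x.
Proof.
move=> ps ker.
have E i x : (g i \o (p i)^-1)%VF (p i x) = g i x.
  rewrite comp_lfunE; apply/eqP; rewrite -subr_eq0 -linearB; apply/eqP/ker.
  by rewrite linearB /= limg_lfunVK ?subrr // memv_img // memvf.
suff hP (i j : 'I_n) (ij : i.+1 == j :> nat) x :
    (g j \o (p j)^-1)%VF (rmap M ij x) = rmap N ij ((g i \o (p i)^-1)%VF x).
  by exists (mk_rhom (f := fun i => (g i \o (p i)^-1)%VF) hP).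
by have /rhom_surjP/(_ i x)[y <-] := ps; rewrite -rhomE !E rhomE.
Qed.

(** Asking only that [f] kill the kernel of [g] amounts to extending from the image of [g]; in this
    form it applies directly to a differential. *)
Definition injective_rep L : Prop :=
  forall M N (g : rhom M N) (f : rhom M L), (forall i x, g i x = 0 -> f i x = 0) ->
    exists h : rhom N L, forall i x, h i (g i x) = f i x.

Lemma res_ker0 M (P : proj_resolution M) i x :
  res_aug P i x = 0 -> exists y, res_diff P 0 i y = x.
Proof.
by move/eqP; rewrite -memv_ker -res_exact0 => /memv_imgP[y _ ->]; exists y.
Qed.

Lemma res_kerS M (P : proj_resolution M) m i x :
  res_diff P m i x = 0 -> exists y, res_diff P m.+1 i y = x.
Proof.
by move/eqP; rewrite -memv_ker -res_exactS => /memv_imgP[y _ ->]; exists y.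
Qed.

Lemma res_diff0 M (P : proj_resolution M) m i x :
  res_diff P m i (res_diff P m.+1 i x) = 0.
Proof. by apply/eqP; rewrite -memv_ker -res_exactS memv_img // memvf. Qed.

Lemma Ext_eq0S m M N :
  Ext_eq0 m.+1 M N <->
  forall (P : proj_resolution M) (f : rhom (P m.+1) N),
    (forall i x, f i (res_diff P m.+1 i x) = 0) ->
    exists g : rhom (P m) N, forall i x, f i x = g i (res_diff P m i x).
Proof.
split=> H P f f0.
  have [|g fg] := H P f.
    by move=> i; apply/lfunP => x; rewrite comp_lfunE f0 zero_lfunE.
  by exists g => i x; rewrite fg comp_lfunE.
have [|g fg] := H P f.
  by move=> i x; rewrite -comp_lfunE f0 zero_lfunE.
by exists g => i; apply/lfunP => x; rewrite fg comp_lfunE.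
Qed.

Lemma Ext_injective m M N : injective_rep N -> (1 <= m)%N -> Ext_eq0 m M N.
Proof.
case: m => // m Ninj _; apply/Ext_eq0S => P f f0.
have [|h hE] := Ninj _ _ (res_diff P m) f; last by exists h => i x; rewrite hE.
by move=> i x /res_kerS[y <-].
Qed.

Lemma projective_lift L M N (g : rhom M N) (f : rhom L N) :
  projective L -> rhom_surj g -> exists h : rhom L M, forall i x, g i (h i x) = f i x.
Proof.
move=> Lproj /Lproj - /(_ f)[h gh]; exists h => i x.
by rewrite -comp_lfunE gh.
Qed.

Definition rsub M N (f g : rhom M N) : rhom M N := radd f (rscale (-1) g).

Lemma rsubE M N (f g : rhom M N) i x : rsub f g i x = f i x - g i x.
Proof. by rewrite /= add_lfunE scale_lfunE scaleN1r. Qed.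

Lemma ridE M i x : rid M i x = x.
Proof. exact: id_lfunE. Qed.

Definition rzero M N : rhom M N.
Proof. by exists (fun i => 0) => i j ij; rewrite comp_lfun0l comp_lfun0r. Defined.

Lemma rcompE L M N (g : rhom M N) (f : rhom L M) i x : rcomp g f i x = g i (f i x).
Proof. by rewrite /= comp_lfunE. Qed.

(** Dimension shift along [0 -> A -> I -> C -> 0]: [Ext^1(N, A)] is the cokernel of
    [Hom(N, I) -> Hom(N, C)], and [Ext^(m+1)(N, A)] is [Ext^m(N, C)] for [m >= 1]. *)
Lemma Ext_shift N A I C (iota : rhom A I) (pi : rhom I C) :
  (forall i x, iota i x = 0 -> x = 0) ->
  (forall i x, pi i x = 0 -> exists y, iota i y = x) ->
  (forall i y, pi i (iota i y) = 0) -> rhom_surj pi -> injective_rep I ->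
  (forall g : rhom N C, exists g' : rhom N I, forall i x, pi i (g' i x) = g i x) ->
  (forall m, (1 <= m)%N -> Ext_eq0 m N C) ->
  forall m, (1 <= m)%N -> Ext_eq0 m N A.
Proof.
move=> iota_inj exact pi_iota pi_surj Iinj lift ExtC [//|m] _.
apply/Ext_eq0S => P f f0.
have [|h hE] := Iinj _ _ (res_diff P m) (rcomp iota f).
  by move=> i x /res_kerS[y <-]; rewrite rcompE f0 linear0.
have {}hE i x : h i (res_diff P m i x) = iota i (f i x) by rewrite hE rcompE.
(* With such a [u], the difference [h - u] lands in [A] and extends [f]. *)
suff [u u0 uE] : exists2 u : rhom (P m) I,
    forall i x, u i (res_diff P m i x) = 0 & forall i x, pi i (u i x) = pi i (h i x).
  have [|h' h'E] := @rhom_lift_mono _ _ _ iota (rsub h u) iota_inj.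
    by move=> i x; apply: exact; rewrite rsubE linearB /= uE subrr.
  exists h' => i x; apply/eqP; rewrite -subr_eq0; apply/eqP/(iota_inj i).
  by rewrite linearB /= h'E rsubE u0 subr0 hE subrr.
(* In degree one, [rcomp pi h] descends to a map [N -> C], which lifts by hypothesis. In higher
   degrees it is a coboundary, and its cochain lifts to [I] by projectivity. *)
case: m => [|m] in f f0 h hE *.
  have [|g gE] := @rhom_desc_epi _ _ _ (res_aug P) (rcomp pi h) (@res_aug_surj _ _ _ P).
    by move=> i x /res_ker0[y <-]; rewrite rcompE hE pi_iota.
  have [g' g'E] := lift g; exists (rcomp g' (res_aug P)) => i x; rewrite rcompE.
    have -> : res_aug P i (res_diff P 0 i x) = 0; last by rewrite linear0.
    by apply/eqP; rewrite -memv_ker -res_exact0 memv_img // memvf.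
  by rewrite g'E gE rcompE.
have [|g gE] := (Ext_eq0S m N C).1 (ExtC m.+1 isT) P (rcomp pi h).
  by move=> i x; rewrite rcompE hE pi_iota.
have [g' g'E] := projective_lift g (@res_projective _ _ _ P m) pi_surj.
exists (rcomp g' (res_diff P m)) => i x; first by rewrite rcompE res_diff0 linear0.
by rewrite rcompE g'E -gE rcompE.
Qed.

Lemma Hom_eq0_iso M M' N N' :
  rep_iso M M' -> rep_iso N N' -> Hom_eq0 M N -> Hom_eq0 M' N'.
Proof.
move=> /rep_isoP[a [a' aa']] /rep_isoP[b [b' bb']] H f i; apply/lfunP => x.
have /lfunP/(_ (a' i x)) := H (rcomp b' (rcomp f a)) i.
rewrite !rcompE (aa' i).2 !zero_lfunE => /(congr1 (b i)).
by rewrite (bb' i).2 linear0.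
Qed.

(** A resolution of [M'] becomes one of [M] by composing its augmentation with the isomorphism
    [a']. *)
Lemma Ext_eq0_iso m M M' N N' : (1 <= m)%N ->
  rep_iso M M' -> rep_iso N N' -> Ext_eq0 m M N -> Ext_eq0 m M' N'.
Proof.
case: m => // m _ /rep_isoP[a [a' aa']] /rep_isoP[b [b' bb']] /Ext_eq0S H.
apply/Ext_eq0S => P f f0.
have surj : rhom_surj (rcomp a' (res_aug P)).
  apply/rhom_surjP => i y; have /rhom_surjP/(_ i (a i y))[x xy] := @res_aug_surj _ _ _ P.
  by exists x; rewrite rcompE xy (aa' i).1.
have ex0 i : limg (res_diff P 0 i) = lker (rcomp a' (res_aug P) i).
  rewrite res_exact0; apply/vspaceP => y; rewrite !memv_ker rcompE.
  apply/eqP/eqP => [->|/(congr1 (a i))]; first by rewrite linear0.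
  by rewrite (aa' i).2 linear0.
pose Q := ProjResolution (@res_projective _ _ _ P) surj ex0 (@res_exactS _ _ _ P).
have [|g gE] := H Q (rcomp b' f); first by move=> i x; rewrite rcompE f0 linear0.
exists (rcomp b g) => i x.
by rewrite rcompE -gE rcompE (bb' i).2.
Qed.

(** The projection onto [A] transports to an endomorphism of [M], a scalar [c]: if [c = 1] then [B]
    vanishes, otherwise [A] does. *)
Lemma brick_indecomposable M :
  ~ rep_zero M -> (forall e : rhom M M, exists c : k, forall i x, e i x = c *: x) ->
  indecomposable M.
Proof.
move=> M0 scal; split=> // A B /rep_isoP[f [g fg]].
pose pr (i : 'I_n) : 'Hom((A i * B i)%type, (A i * B i)%type) :=
  linfun (fun x : A i * B i => (x.1, 0)).
have prE i x : pr i x = (x.1, 0).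
  rewrite linfunE // => c u v; congr (_, _) => /=.
  by rewrite scaler0 addr0.
have prP (i j : 'I_n) (ij : i.+1 == j :> nat) (x : dsum A B i) :
    pr j (rmap (dsum A B) ij x) = rmap (dsum A B) ij (pr i x).
  by rewrite /= !dsum_mapE !prE /= linear0.
pose p : rhom (dsum A B) (dsum A B) := @mk_rhom k n (dsum A B) (dsum A B) pr prP.
have [c cE] := scal (rcomp g (rcomp p f)).
have pE i (x : dsum A B i) : (x.1, 0) = c *: x.
  have := congr1 (f i) (cE i (g i x)).
  by rewrite !rcompE linearZ /= !(fg i).2 prE.
have [c1|c1] := eqVneq c 1; [right|left] => i x.
  by have /(congr1 snd) := pE i (0, x); rewrite c1 scale1r.
have /(congr1 fst) /= /eqP := pE i (x, 0).
by rewrite -subr_eq0 -{1}[x]scale1r -scalerBl scaler_eq0 subr_eq0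
  eq_sym (negPf c1) => /eqP.
Qed.

Lemma scalar_End_iso_k M :
  ~ rep_zero M -> (forall e : rhom M M, exists c : k, forall i x, e i x = c *: x) ->
  End_iso_k M.
Proof.
move=> M0 scal.
have [i [x x0]] : exists i (x : M i), x <> 0.
  by apply: NNPP => no; apply: M0 => i x; apply: NNPP => x0; apply: no; exists i, x.
pose phi c := rscale c (rid M).
have phiE c j y : phi c j y = c *: y by rewrite /= scale_lfunE id_lfunE.
exists phi; split; last first.
  move=> a b c j; apply/lfunP => y.
  by rewrite [RHS]add_lfunE [X in _ = X + _]scale_lfunE !phiE scalerDl scalerA.
have [l lx] := dual_vec x0; exists (fun e : rhom M M => l (e i x)) => [c|e].
  by rewrite phiE linearZ /= lx [_ *: _]mulr1.
have [c cE] := scal e; apply: eq_rhom => j; apply/lfunP => y.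
by rewrite phiE !cE linearZ /= lx [X in X *: _]mulr1.
Qed.

End Homological.

(** The positive branch receives the proof of the condition, which below is the arrow that [rmap]
    takes as argument. *)
Definition dep_if (T : Type) (b : bool) (y : T) : (b -> T) -> T :=
  if b return (b -> T) -> T then fun F => F isT else fun=> y.

Lemma dep_ifT (T : Type) (b : bool) (y : T) (F : b -> T) (h : b) : dep_if y F = F h.
Proof. by case: b F h => // F h; congr F; apply: bool_irrelevance. Qed.

Lemma dep_ifF (T : Type) (b : bool) (y : T) (F : b -> T) : ~~ b -> dep_if y F = y.
Proof. by case: b F. Qed.

(** * Morphisms and extensions between thin modules *)

Section ThinModules.
Variables (k : fieldType) (n : nat).
Implicit Types L M N : rep k n.
Local Notation thin := (@thin k n).
Local Notation S := (thin true).
Local Notation P := (thin false).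

Lemma simple_hom_out M (a : 'I_n) (z : M a) :
  (forall (j : 'I_n) (aj : a.+1 == j :> nat), rmap M aj z = 0) ->
  exists h : rhom (S a) M, h a (gen k true a a) = z.
Proof.
move=> z0; pose w i : M i := dfwith (fun i => 0 : M i) z i.
have hP (i j : 'I_n) (ij : i.+1 == j :> nat) (x : S a i) :
    thin_from true a j (w j) (rmap (S a) ij x) = rmap M ij (thin_from true a i (w i) x).
  rewrite thin_fromE coor_rmap thin_fromE linearZ /=.
  have [si|/coor_out ->] := boolP (supp true a i); last by rewrite mul0rn !scale0r.
  have ia : i = a by apply: ord_inj; move: si; rewrite /supp orbF => /eqP.
  have sj : supp true a j = false by move: si ij; rewrite /supp; lia.
  rewrite sj mulr0n scale0r; subst i.
  by rewrite /w dfwith_in z0 scaler0.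
exists (@mk_rhom k n (S a) M (fun i => thin_from true a i (w i)) hP).
by rewrite /= thin_fromE coor_gen /supp eqxx scale1r /w dfwith_in.
Qed.

(** The generators at [a] and [a.+1] go to [z] and its image; the next arrow kills that image
    because consecutive arrows compose to zero. *)
Lemma proj_hom_out M (a : 'I_n) (z : M a) :
  exists h : rhom (P a) M, h a (gen k false a a) = z.
Proof.
pose w i : M i := 
  dep_if (dfwith (fun i => 0 : M i) z i) (fun ai : a.+1 == i :> nat => rmap M ai z).
have wS (i : 'I_n) (ai : a.+1 == i :> nat) : w i = rmap M ai z by rewrite /w dep_ifT.
have wa : w a = z by rewrite /w dep_ifF ?dfwith_in //; lia.
have hP (i j : 'I_n) (ij : i.+1 == j :> nat) (x : P a i) :
    thin_from false a j (w j) (rmap (P a) ij x) = rmap M ij (thin_from false a i (w i) x).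
  rewrite thin_fromE coor_rmap thin_fromE linearZ /=.
  have [si|/coor_out ->] := boolP (supp false a i); last by rewrite mul0rn !scale0r.
  have [ia|ia] := eqVneq i a.
    subst i; have sj : supp false a j by move: ij; rewrite /supp; lia.
    by rewrite sj mulr1n wS wa.
  have sj : supp false a j = false.
    by move: si ij ia; rewrite /supp -val_eqE /=; lia.
  have ai : a.+1 == i :> nat by move: si ia; rewrite /supp -val_eqE /=; lia.
  by rewrite sj mulr0n scale0r (wS _ ai) rmap_rmap0 scaler0.
exists (@mk_rhom k n (P a) M (fun i => thin_from false a i (w i)) hP).
by rewrite /= thin_fromE coor_gen /supp eqxx scale1r wa.
Qed.

(* [b] is the vertex of the socle of [thin s a]. *)
Lemma hom_into_thin M s a (b : 'I_n) (l : 'Hom(M b, k^o)) :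
  supp s a b ->
  (forall i : 'I_n, supp s a i -> i = b \/ i.+1 = b :> nat) ->
  (forall (i : 'I_n) (ib : i.+1 == b :> nat), supp s a i \/ (l \o rmap M ib)%VF = 0) ->
  exists h : rhom M (thin s a), forall x, coor (h b x) = l x.
Proof.
move=> sb slow sb'; pose w i : 'Hom(M i, k^o) := 
  dep_if (dfwith (fun i => 0 : 'Hom(M i, k^o)) l i)
    (fun ib : i.+1 == b :> nat => (l \o rmap M ib)%VF).
have wS (i : 'I_n) (ib : i.+1 == b :> nat) : w i = (l \o rmap M ib)%VF.
  by rewrite /w dep_ifT.
have wb : w b = l by rewrite /w dep_ifF ?dfwith_in //; lia.
have hP (i j : 'I_n) (ij : i.+1 == j :> nat) (x : M i) :
    thin_to s a j (w j) (rmap M ij x) = rmap (thin s a) ij (thin_to s a i (w i) x).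
  apply: coor_inj; rewrite coor_rmap !coor_thin_to.
  have [sj|_] := boolP (supp s a j); last by rewrite !mulr0n.
  rewrite !mulr1n; have [jb|jb] := slow j sj.
    subst j; rewrite wb (wS _ ij) comp_lfunE.
    have [->//|/lfunP/(_ x)] := sb' i ij.
    by rewrite comp_lfunE zero_lfunE => ->; rewrite mul0rn.
  have jb' : j.+1 == b :> nat by apply/eqP.
  rewrite (wS _ jb') comp_lfunE rmap_rmap0 linear0.
  suff -> : supp s a i = false by rewrite mulr0n.
  by apply: contraTF (ij) => /slow [->|]; lia.
exists (@mk_rhom k n M (thin s a) (fun i => thin_to s a i (w i)) hP) => x.
by rewrite /= coor_thin_to sb wb.
Qed.

Lemma proj_thin a : projective (P a).
Proof.
move=> M N g f /rhom_surjP gs; have [an|an] := ltnP a n; last first.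
  have z0 i (x : P a i) : x = 0.
    by apply: thin_zero; have := ltn_ord i; rewrite /supp; lia.
  by exists (rzero _ _) => i; apply/lfunP => x; rewrite (z0 i x) !linear0.
pose a' := Ordinal an; have [z gz] := gs a' (f a' (gen k false a a')).
have [h hz] := @proj_hom_out M a' z; exists h.
have := @thin_hom_eq k n a' false N (rcomp g h) f.
by apply; rewrite rcompE hz.
Qed.

Lemma hom_into_thin_eq M s a (b : 'I_n) (f g : rhom M (thin s a)) :
  supp s a b ->
  (forall i : 'I_n, supp s a i -> i = b \/ i.+1 = b :> nat) ->
  (forall x, coor (f b x) = coor (g b x)) -> forall i x, f i x = g i x.
Proof.
move=> sb slow e i x; have [si|si] := boolP (supp s a i); last first.
  by rewrite [LHS]thin_zero // [RHS]thin_zero.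
apply: coor_inj; have [ib|ib] := slow i si; first by subst i.
have ib' : i.+1 == b :> nat by apply/eqP.
have E := @coor_rmap k n s a i b ib'; rewrite sb in E.
by rewrite -[LHS](E (f i x)) -[RHS](E (g i x)) -!rhomE e.
Qed.

(** The last hypothesis lets every functional at the socle vertex [b] define a map into [thin s a];
    it remains to extend the functional given by [f b] along [g b]. *)
Lemma inj_thin s a (b : 'I_n) :
  supp s a b ->
  (forall i : 'I_n, supp s a i -> i = b \/ i.+1 = b :> nat) ->
  (forall i : 'I_n, i.+1 = b :> nat -> supp s a i) -> injective_rep (thin s a).
Proof.
move=> sb slow sb' M N g f ker.
have coor_lin : linear (@coor k n s a b : _ -> k^o).
  by move=> c x y; rewrite /coor (bval_linear (b := supp s a b)).
pose l := (linfun (@coor k n s a b : _ -> k^o) \o f b \o (g b)^-1)%VF.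
have lE x : l (g b x) = coor (f b x).
  rewrite !comp_lfunE linfunE //; congr coor; apply/eqP.
  rewrite -subr_eq0 -linearB; apply/eqP/ker.
  by rewrite linearB /= limg_lfunVK ?subrr // memv_img // memvf.
have [|h hE] := @hom_into_thin N s a b l sb slow.
  by move=> i ib; left; apply/sb'/eqP.
exists h => i x; rewrite -rcompE; apply: (hom_into_thin_eq (b := b)) => // y.
by rewrite rcompE hE lE.
Qed.

Lemma inj_P a : (a.+1 < n)%N -> injective_rep (P a).
Proof.
move=> an; apply: (inj_thin (b := Ordinal an)); rewrite /supp /=; first by lia.
  by move=> i /orP[]/eqP e; [right; rewrite e|left; apply: ord_inj].
by move=> i; lia.
Qed.

Lemma inj_S0 : (0 < n)%N -> injective_rep (S 0).
Proof.
move=> an; apply: (inj_thin (b := Ordinal an)); rewrite /supp //=.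
by move=> i /orP[]/eqP // i0; left; apply: ord_inj.
Qed.

Lemma proj_S_compat a : thin_compat n false a true a.
Proof. by move=> v _; rewrite /supp; lia. Qed.

Lemma S_proj_compat a : thin_compat n true a.+1 false a.
Proof. by move=> v _; rewrite /supp; lia. Qed.

Lemma proj_proj_compat a : thin_compat n false a.+1 false a.
Proof. by move=> v _; rewrite /supp; lia. Qed.

(** Induction along [0 -> S_(j+1) -> P_j -> S_j -> 0], starting from the injective [S_0]; [lift] is
    the surjectivity on Hom that each shift requires. *)
Lemma Ext_simple N j : (j < n)%N ->
  (forall l, (l < j)%N -> forall g : rhom N (S l), exists g' : rhom N (P l),
     forall i x, thin_hom k (@proj_S_compat l) i (g' i x) = g i x) ->
  forall m, (1 <= m)%N -> Ext_eq0 m N (S j).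
Proof.
elim: j => [|j IH] jn lift.
  by move=> m; apply: Ext_injective; apply: inj_S0.
apply: (@Ext_shift k n N _ (P j) (S j) (thin_hom k (@S_proj_compat j))
  (thin_hom k (@proj_S_compat j))).
- by apply: thin_hom_inj => v; rewrite /supp; lia.
- move=> i x /eqP; rewrite -memv_ker.
  rewrite -(@thin_hom_exact k n _ _ _ _ _ _ (@S_proj_compat j)).
    by case/memv_imgP => y _ ->; exists y.
  by rewrite /supp; lia.
- move=> i y; apply: coor_inj; rewrite !thin_homE -mulrnA coor0.
  have [si|/coor_out ->] := boolP (supp true j.+1 i); last by rewrite mul0rn.
  suff -> : (supp false j i * supp true j i = 0)%N by rewrite mulr0n.
  by move: si; rewrite /supp; lia.
- by apply: thin_hom_surj => v; rewrite /supp; lia.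
- exact: inj_P.
- exact: lift.
- by apply: IH => [|l lj]; [lia | apply: lift; lia].
Qed.

Lemma Ext_projective_simple N j : projective N -> (j < n)%N ->
  forall m, (1 <= m)%N -> Ext_eq0 m N (S j).
Proof.
move=> Nproj jn; apply: Ext_simple => // l lj g.
by apply: projective_lift => //; apply: thin_hom_surj => v; rewrite /supp; lia.
Qed.

Lemma Hom_simple_neq i j : i != j -> Hom_eq0 (S i) (S j).
Proof. by move=> ij; apply: thin_hom_eq0 => v; rewrite /supp; lia. Qed.

Lemma Ext_simple_simple i j : (j < n)%N -> (j <= i)%N ->
  forall m, (1 <= m)%N -> Ext_eq0 m (S i) (S j).
Proof.
move=> jn ji; apply: Ext_simple => // l lj g.
exists (rzero _ _) => v x; rewrite zero_lfunE linear0.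
by rewrite (Hom_simple_neq (i := i) (j := l)) ?zero_lfunE //; lia.
Qed.

Definition simple_resolution (i : nat) : proj_resolution (S i).
Proof.
refine (@ProjResolution k n (S i) (fun m => P (m + i)%N)
  (fun m => thin_hom k (@proj_proj_compat (m + i)%N))
  (thin_hom k (@proj_S_compat i)) _ _ _ _).
- by move=> m; apply: proj_thin.
- by apply: thin_hom_surj => v; rewrite /supp; lia.
- by move=> v; apply: thin_hom_exact; rewrite /supp; lia.
- by move=> m v; apply: thin_hom_exact; rewrite /supp; lia.
Defined.

(** The projection [P_(m+1+i) -> S_(m+1+i)] is a cocycle but no coboundary: the differential sends
    the generator to the image, under an arrow, of a vector at a vertex where the simple
    vanishes. *)
Lemma Ext_simple_neq0 i m : (m.+1 + i < n)%N -> ~ Ext_eq0 m.+1 (S i) (S (m.+1 + i)).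
Proof.
move=> jn /Ext_eq0S /(_ (simple_resolution i)) H0.
(* This is [H0] with the fields of [simple_resolution] computed, by conversion. *)
have H : forall f : rhom (P (m.+1 + i)) (S (m.+1 + i)),
    (forall v x, f v (thin_hom k (@proj_proj_compat (m.+1 + i)) v x) = 0) ->
    exists g : rhom (P (m + i)) (S (m.+1 + i)),
      forall v x, f v x = g v (thin_hom k (@proj_proj_compat (m + i)) v x) := H0.
have [|g gE] := H (thin_hom k (@proj_S_compat (m.+1 + i))).
  move=> v x; apply: coor_inj; rewrite !thin_homE -mulrnA coor0.
  have [sv|/coor_out ->] := boolP (supp false (m.+2 + i) v); last by rewrite mul0rn.
  suff -> : (supp false (m.+1 + i) v * supp true (m.+1 + i) v = 0)%N by rewrite mulr0n.
  by move: sv; rewrite /supp; lia.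
have mn : (m + i < n)%N by lia.
pose u := Ordinal mn; pose v := Ordinal jn.
have uv : u.+1 == v :> nat by rewrite /= addSn.
have su : supp false (m + i) u by rewrite /supp /=; lia.
have sv : supp true (m.+1 + i) v by rewrite /supp /= eqxx.
have sv' : supp false (m.+1 + i) v by rewrite /supp /= eqxx.
have /(congr1 (@coor _ _ _ _ _)) := gE v (gen k false (m.+1 + i) v).
rewrite thin_homE coor_gen sv sv' => /eqP; apply/negP.
suff -> : g v (thin_hom k (@proj_proj_compat (m + i)) v (gen k false (m.+1 + i) v)) = 0.
  by rewrite coor0 oner_eq0.
have -> : thin_hom k (@proj_proj_compat (m + i)) v (gen k false (m.+1 + i) v) =
    rmap (P (m + i)) uv (gen k false (m + i) u).
  by apply: coor_inj; rewrite [RHS]coor_rmap [LHS]thin_homE !coor_gen su sv'.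
rewrite rhomE (thin_zero (g u _)) ?linear0 //.
by rewrite /supp /=; lia.
Qed.

End ThinModules.

(** * Classification *)

Section Exceptional.
Variables (k : fieldType) (n : nat).
Implicit Types L M N : rep k n.
Local Notation thin := (@thin k n).
Local Notation S := (thin true).
Local Notation P := (thin false).

Definition label_rep (x : label n) : rep k n := thin x.1 x.2.

Lemma thin_neq0 s (a : 'I_n) : ~ rep_zero (thin s a).
Proof.
move/(_ a (gen k s a a))/(congr1 (@coor _ _ _ _ _)).
by rewrite coor_gen coor0 /supp eqxx => /eqP; rewrite oner_eq0.
Qed.

Lemma thin_scalar s (a : 'I_n) (e : rhom (thin s a) (thin s a)) :
  exists c : k, forall i x, e i x = c *: x.
Proof.
exists (coor (e a (gen k s a a))) => i x.
rewrite (@thin_hom_eq k n a s _ e (rscale (coor (e a (gen k s a a))) (rid _))).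
  by rewrite scale_lfunE id_lfunE.
by rewrite scale_lfunE id_lfunE -coor_genE.
Qed.

Lemma thin_exceptional s (a : 'I_n) :
  label_valid (s, a) -> exceptional (thin s a).
Proof.
move=> va; split; first exact: (brick_indecomposable (@thin_neq0 s a) (@thin_scalar s a)).
  exact: (scalar_End_iso_k (@thin_neq0 s a) (@thin_scalar s a)).
case: s va => va m m1; first exact: Ext_simple_simple.
exact/Ext_injective/m1/inj_P.
Qed.

Lemma label_pairP (x y : label n) : label_valid x -> label_valid y ->
  (Hom_eq0 (label_rep y) (label_rep x) /\
   forall m, (1 <= m)%N -> Ext_eq0 m (label_rep y) (label_rep x)) <-> label_prec x y.
Proof.
case: x y => s [j jn] [s' [i iN]]; rewrite /label_valid /label_rep /= => vx vy.
split=> [[H0 E0]|]; last first.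
  case: s s' vx vy => -[] /= vx vy ij; split.
  - by apply: thin_hom_eq0 => v; rewrite /supp; lia.
  - by apply: Ext_simple_simple => //; lia.
  - by apply: thin_hom_eq0 => v; rewrite /supp; lia.
  - by apply: Ext_projective_simple => //; apply: proj_thin.
  - by apply: thin_hom_eq0 => v; rewrite /supp; lia.
  - by move=> m; apply: Ext_injective; apply: inj_P.
  - by apply: thin_hom_eq0 => v; rewrite /supp; lia.
  - by move=> m; apply: Ext_injective; apply: inj_P.
have nz v (vn : (v < n)%N) : thin_compat n s' i s j -> supp s' i v -> supp s j v -> False.
  by move=> co s1 s2; apply: (thin_hom_neq0 (v := Ordinal vn) co s1 s2 H0).
apply/negP => /negP np.
(* If [i = j] or [i = j.+1], a nonzero map exists at vertex [i]. The remaining failure is two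
   simples with [i < j], where [Ext^(j-i)] is nonzero. *)
have [eij|ij] := eqVneq i j.
  apply: (nz i iN); rewrite /thin_compat /supp; [|lia|];
    move: np vx vy; case: (s) (s') => -[] /=; lia.
have [[ss ss'] |] : (s = true /\ s' = true) \/ i = j.+1.
  by move: np vx vy; case: (s) (s') => -[] /=; lia.
  subst s s'; move: np => /= np; have e : j = ((j - i).-1.+1 + i)%N by lia.
  apply: (@Ext_simple_neq0 k n i (j - i).-1); rewrite -?e //.
  by apply: E0.
move=> eij; subst i; apply: (nz j.+1 iN); rewrite /thin_compat /supp;
    move: np vx vy; case: (s) (s') => -[] /=; lia.
Qed.

(** Isomorphic modules have equal supports, and the support determines a valid label; validity
    excludes [P_(n-1)], which coincides with [S_(n-1)]. *)
Lemma label_rep_inj (x y : label n) : label_valid x -> label_valid y ->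
  rep_iso (label_rep x) (label_rep y) -> x = y.
Proof.
have sub (z t : label n) v : (v < n)%N -> rep_iso (label_rep z) (label_rep t) ->
    supp z.1 z.2 v -> supp t.1 t.2 v.
  move=> vn /rep_isoP[f [g fg]] sz; apply: contraT => st.
  have := (fg (Ordinal vn)).1 (gen k z.1 z.2 (Ordinal vn)).
  rewrite (thin_zero (f _ _)) // linear0 => /(congr1 (@coor _ _ _ _ _)).
  by rewrite coor0 coor_gen sz => /esym/eqP; rewrite oner_eq0.
move=> vx vy xy; have yx := rep_iso_sym xy.
case: x y vx vy xy yx => s a [s' a']; rewrite /label_valid /= => vx vy xy yx.
have sE v : (v < n)%N -> supp s a v = supp s' a' v.
  by move=> vn; apply/idP/idP; [apply: (sub _ _ _ vn xy)|apply: (sub _ _ _ vn yx)].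
have := (sE a (ltn_ord a), sE a' (ltn_ord a')); rewrite /supp => -[e1 e2].
have [e3 e4] := (sE a.+1, sE a'.+1); move: e3 e4 vx vy; rewrite /supp => e3 e4 vx vy.
clear xy yx sE.
have ea : a = a' by apply: ord_inj; case: s s' e1 e2 e3 e4 vx vy => -[]; lia.
subst a'; congr (_, _); case: s s' e1 e2 e3 e4 vx vy => -[] //=; lia.
Qed.

(** If an arrow out of [i] acts nontrivially, [P_i] is a retract of [M]; if none does, some [S_i]
    is. As the endomorphisms are scalars, a nonzero retract is all of [M]. *)
Lemma brick_thin M : ~ rep_zero M ->
  (forall e : rhom M M, exists c : k, forall i x, e i x = c *: x) ->
  exists2 x, label_valid x & rep_iso M (label_rep x).
Proof.
move=> M0 scal.
have retract s (a : 'I_n) (f : rhom M (thin s a)) (g : rhom (thin s a) M) i (y : M i) :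
    g i (f i y) = y -> y <> 0 -> f a (g a (gen k s a a)) = gen k s a a ->
    rep_iso M (thin s a).
  move=> gfy y0 fg; apply/rep_isoP; exists f, g => j; split=> [z|z].
    have [c cE] := scal (rcomp g f).
    have c1 : c = 1.
      have := cE i y; rewrite rcompE gfy -{1}[y]scale1r => /eqP.
      rewrite -subr_eq0 -scalerBl scaler_eq0 subr_eq0.
      by case/orP => /eqP.
    by rewrite -rcompE cE c1 scale1r.
  rewrite -rcompE (@thin_hom_eq k n a s _ (rcomp f g) (rid _)) ?ridE //.
  by rewrite rcompE fg.
have [[i [j [ij [x y0]]]]|no] :=
    classic (exists (i j : 'I_n) (ij : i.+1 == j :> nat) x, rmap M ij x <> 0).
  (* With [l] equal to 1 on the image of [x], the map [h] to [P_i] sends [x] to the generator and so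
     splits the map [g] defined by [x]. *)
  have [l ly] := dual_vec y0.
  have sj : supp false i j by move/eqP: (ij); rewrite /supp; lia.
  have si : supp false i i by rewrite /supp eqxx.
  have [||h hE] := @hom_into_thin k n M false i j l sj.
    move=> v; rewrite /supp => /orP[]/eqP e.
      by right; rewrite e; exact/eqP.
    by left; apply: ord_inj; rewrite e; exact/eqP.
    by move=> v vj; left; move: vj; move/eqP: (ij); rewrite /supp; lia.
  have [g gE] := @proj_hom_out k n M i x.
  have fg : h i x = gen k false i i.
    apply: coor_inj; rewrite coor_gen si.
    have := @coor_rmap k n false i i j ij (h i x).
    by rewrite sj -rhomE hE ly mulr1n => <-.
  have fgj : h j (rmap M ij x) = gen k false i j by rewrite rhomE fg gen_succ.
  exists (false, i); first by rewrite /label_valid /=; move/eqP: (ij) => ->.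
  apply: (retract false i h g j (rmap M ij x)) => //.
    by rewrite fgj -(gen_succ k ij si) rhomE gE.
  by rewrite gE.
have rmap0 (i j : 'I_n) (ij : i.+1 == j :> nat) x : rmap M ij x = 0.
  by apply: NNPP => H; apply: no; exists i, j, ij, x.
have [i [x x0]] : exists i (x : M i), x <> 0.
  by apply: NNPP => H; apply: M0 => i x; apply: NNPP => x0; apply: H; exists i, x.
have [l lx] := dual_vec x0.
have si : supp true i i by rewrite /supp eqxx.
have [||h hE] := @hom_into_thin k n M true i i l si.
- by move=> v; rewrite /supp orbF => /eqP e; left; apply: ord_inj.
- by move=> v vi; right; apply/lfunP => z; rewrite comp_lfunE rmap0 linear0 zero_lfunE.
have [|g gE] := @simple_hom_out k n M i x; first by move=> j ij; apply: rmap0.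
have fg : h i x = gen k true i i by apply: coor_inj; rewrite hE lx coor_gen si.
exists (true, i) => //; apply: (retract true i h g i x) => //; first by rewrite fg.
by rewrite gE.
Qed.

End Exceptional.

Theorem theorem1p3 (k : closedFieldType) (n : nat) (hn : (1 <= n)%N) :
  num_complete_exceptional_seqs k n
    (\sum_(1 <= j < n.+1) 'C(n, j) * j ^ (n - j))%N.
Proof.
have cardE : (#|exc_words n| = \sum_(1 <= j < n.+1) 'C(n, j) * j ^ (n - j))%N.
  (* The term for [j = 0] is [0 ^ n], which vanishes because [n] is positive. *)
  by rewrite card_exc_words big_ltn // subn0 exp0n // muln0.
pose w a := enum_val (cast_ord (esym cardE) a).
have wP a : w a \in exc_words n by apply: enum_valP.
exists (fun a i => label_rep k (w a i)); split=> [a|s [s_exc s_pair]].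
  have /exc_wordsP[valid prec] := wP a.
  have exc i : exceptional (label_rep k (w a i)).
    by apply: thin_exceptional; case: (w a i) (valid i).
  split=> // i j ij.
  have [H E] := (label_pairP k (valid i) (valid j)).2 (prec i j ij).
  by split.
have /fin_all_exists2[x xv xE] i :
    exists2 x, label_valid x & rep_iso (s i) (label_rep k x).
  have [[M0 _] endM _] := s_exc i.
  exact: (brick_thin M0 (End_scalar endM M0)).
have xw : finfun x \in exc_words n.
  apply/exc_wordsP; split=> [p|p q pq]; first by rewrite ffunE.
  rewrite !ffunE; apply/(label_pairP k (xv p) (xv q)).
  have [_ _ H E] := s_pair p q pq; split; first exact: (Hom_eq0_iso (xE q) (xE p) H).
  by move=> m m1; apply: (Ext_eq0_iso m1 (xE q) (xE p) (E m m1)).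
exists (cast_ord cardE (enum_rank_in xw (finfun x))); split.
  by move=> i; rewrite /w cast_ordK enum_rankK_in // ffunE; apply: xE.
(* Uniqueness: the letters of [w a] are forced, because valid labels with isomorphic modules are
   equal. *)
move=> a ha; suff e : finfun x = w a.
  apply: (canLR (cast_ordKV _)).
  by rewrite -[RHS](enum_valK_in xw) -/(w a) -e.
apply/ffunP => i; rewrite ffunE; have /exc_wordsP[wv _] := wP a.
apply: (label_rep_inj (xv i) (wv i)); apply: rep_iso_trans (ha i).
exact/rep_iso_sym/xE.
Qed.
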